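(* Let $d\ge1$, $r\in\mathbb N$ with $r\ge1$, $\alpha>0$, and let $\Phi\in\mathrm{CP}_r(\mathbb R^d)$ be real-valued with $|\Phi(x)|\le C(1+\|x\|^\alpha)$ for all $x$. Let $\Xi=\{\xi_1,\dots,\xi_N\}\subset\mathbb R^d$, $N=\binom{d+r-1}{r-1}$, be unisolvent for $\Pi_{r-1}(\mathbb R^d)$ with Lagrange basis $p_1,\dots,p_N$ ($p_j(\xi_k)=\delta_{jk}$), let $\tilde K(x,y):=\Phi(x-y)$ and $$K(x,y):=\Phi(x-y)-\sum_{j=1}^Np_j(x)\Phi(\xi_j-y)-\sum_{k=1}^Np_k(y)\Phi(x-\xi_k)+\sum_{j,k=1}^Np_j(x)p_k(y)\Phi(\xi_j-\xi_k).$$ Set $\beta:=\max\{r-1,(r-1+\alpha)/2\}$ and $\sigma:=\mu-\nu$. Then: (i) if $\mu,\nu\in\mathcal M_\alpha(\mathbb R^d)$, then $\tilde K\in L^1(|\sigma|\otimes|\sigma|)$, so $\mathcal D_{\tilde K}^2(\mu,\nu):=\int\!\!\int\tilde K(x,y)\,\mathrm d\sigma(x)\mathrm d\sigma(y)$ is well defined; (ii) if $\mu,\nu\in\mathcal M_\beta(\mathbb R^d)$, then $K\in L^1(|\sigma|\otimes|\sigma|)$, so $\mathcal D_K^2(\mu,\nu):=\int\!\!\int K(x,y)\,\mathrm d\sigma(x)\mathrm d\sigma(y)$ is well defined; (iii) if $\mu,\nu\in\mathcal M_\alpha(\mathbb R^d)\cap\mathcal M_\beta(\mathbb R^d)$ satisfy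 $\int p\,\mathrm d\mu=\int p\,\mathrm d\nu$ for all $p\in\Pi_{r-1}(\mathbb R^d)$, then $\mathcal D_{\tilde K}^2(\mu,\nu)=\mathcal D_K^2(\mu,\nu)$.
   Context: $\Pi_{r-1}(\mathbb R^d)$: $d$-variate real polynomials of degree $\le r-1$; $\Xi$ is unisolvent if the only $p\in\Pi_{r-1}$ vanishing on $\Xi$ is $p=0$. $\mathrm{CP}_r(\mathbb R^d)$: continuous even $g$ with $\sum_{j,k}a_j\bar a_kg(x_j-x_k)\ge0$ for all $x_1,\dots,x_M$ and all $a\ne0$ with $\sum_ja_jp(x_j)=0$ for all $p\in\Pi_{r-1}(\mathbb R^d)$. It is known that $K$ is then a positive definite kernel. $\mathcal M_\alpha(\mathbb R^d)$: finite signed Radon measures $\mu$ with $\int\|x\|^\alpha\mathrm d|\mu|<\infty$. *)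

(* Defs.v *)
From HB Require Import structures.
From mathcomp Require Import all_boot all_algebra.
From mathcomp Require Import all_classical all_reals all_analysis.

Set Implicit Arguments.
Unset Strict Implicit.
Unset Printing Implicit Defensive.

Import order.Order.TTheory GRing.Theory Num.Theory.
Import numFieldNormedType.Exports.
From mathcomp Require Import complex.

Local Open Scope ring_scope.

Section signed.
Context {R : realType} {dT : measure_display} {T : measurableType dT}.

Lemma hahn_ex (nu : {charge set T -> \bar R}) :
  exists PN : set T * set T, hahn_decomposition nu PN.1 PN.2.
Proof. by have [P [N h]] := Hahn_decomposition nu; exists (P, N). Qed.

Definition hahnPN (nu : {charge set T -> \bar R}) : set T * set T :=
  projT1 (cid (hahn_ex nu)).
Definition hahnP (nu : {charge set T -> \bar R}) :
  hahn_decomposition nu (hahnPN nu).1 (hahnPN nu).2 :=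
  projT2 (cid (hahn_ex nu)).

Definition cpos (nu : {charge set T -> \bar R}) := jordan_pos (hahnP nu).
Definition cneg (nu : {charge set T -> \bar R}) := jordan_neg (hahnP nu).
Definition cvar (nu : {charge set T -> \bar R}) := charge_variation (hahnP nu).

Definition cintegral (nu : {charge set T -> \bar R}) (f : T -> \bar R) : \bar R :=
  (\int[cpos nu]_x f x - \int[cneg nu]_x f x)%E.

Definition cintegral2 (nu : {charge set T -> \bar R}) (f : T * T -> \bar R)
  : \bar R :=
  (\int[(cpos nu \x cpos nu)%E]_z f z - \int[(cpos nu \x cneg nu)%E]_z f z
   - \int[(cneg nu \x cpos nu)%E]_z f z + \int[(cneg nu \x cneg nu)%E]_z f z)%E.

End signed.

Section Rd.
Context {R : realType} (d : nat).

Definition enorm (x : 'rV[R]_d) : R := Num.sqrt (\sum_i x ord0 i ^+ 2).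

Definition Rd := g_sigma_algebraType (@open 'rV[R]_d).

Definition monomial (a : 'I_d -> nat) (x : 'rV[R]_d) : R :=
  \prod_i x ord0 i ^+ a i.

Definition poly_le (n : nat) (p : 'rV[R]_d -> R) : Prop :=
  exists c : {ffun 'I_d -> 'I_n.+1} -> R, forall x,
    p x = \sum_(a : {ffun 'I_d -> 'I_n.+1} | (\sum_i (a i : nat) <= n)%N)
            c a * monomial (fun i => a i) x.

Definition CP (r : nat) (g : 'rV[R]_d -> R) : Prop :=
  [/\ continuous g,
      (forall x, g (- x) = g x) &
      forall (M : nat) (x : 'I_M -> 'rV[R]_d) (a : 'I_M -> R[i]),
        (exists j, a j != 0) ->
        (forall p, poly_le r.-1 p -> \sum_j a j * (p (x j))%:C%C = 0) ->
        0 <= \sum_j \sum_k a j * (a k)^* * (g (x j - x k))%:C%C].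

Definition unisolvent (r N : nat) (xi : 'I_N -> 'rV[R]_d) : Prop :=
  forall p, poly_le r.-1 p -> (forall k, p (xi k) = 0) -> forall x, p x = 0.

Definition lagrange_basis (r N : nat) (xi : 'I_N -> 'rV[R]_d)
    (pl : 'I_N -> 'rV[R]_d -> R) : Prop :=
  (forall j, poly_le r.-1 (pl j)) /\ (forall j k, pl j (xi k) = (j == k)%:R).

Definition Ktilde (Phi : 'rV[R]_d -> R) (x y : 'rV[R]_d) : R := Phi (x - y).

Definition Kred (Phi : 'rV[R]_d -> R) (N : nat) (xi : 'I_N -> 'rV[R]_d)
    (pl : 'I_N -> 'rV[R]_d -> R) (x y : 'rV[R]_d) : R :=
  Phi (x - y) - \sum_j pl j x * Phi (xi j - y) - \sum_k pl k y * Phi (x - xi k)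
  + \sum_j \sum_k pl j x * pl k y * Phi (xi j - xi k).

(* M_alpha(R^d): finite signed (Borel = Radon) measures with finite alpha-moment *)
Definition Mmom (alpha : R) (mu : {charge set Rd -> \bar R}) : Prop :=
  (\int[cvar mu]_x (enorm x `^ alpha)%:E < +oo)%E.

Definition csub (mu nu : {charge set Rd -> \bar R}) : {charge set Rd -> \bar R} :=
  cadd mu (copp nu).

End Rd.

(* Main.v *)
Require Import Defs.
From HB Require Import structures.
From mathcomp Require Import all_boot all_algebra.
From mathcomp Require Import all_classical all_reals all_analysis.

Import order.Order.TTheory GRing.Theory Num.Theory.
Import numFieldNormedType.Exports.
From mathcomp Require Import measurable_realfun complex ring lra.

Local Open Scope ring_scope.
Set Implicit Arguments.
Unset Strict Implicit.
Unset Printing Implicit Defensive.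

(* The weight max(1, |x|)^s turns sums of exponents into products, and |Phi (x - y)| is bounded by a constant
   times the product of the alpha-weights of x and y, which gives (i).

   Testing conditional positivity of Phi on the points x, y, xi_1, ..., xi_N, where the coefficients of the xi_j are
   chosen so that the combination annihilates polynomials, shows that the 2x2 matrices of K are positive semidefinite;
   since K(x, x) is bounded by the square of the beta-weight, the Cauchy-Schwarz inequality bounds |K(x, y)| by the
   product of the beta-weights, which gives (ii).

   Finally Ktilde - K is a finite sum of products F(x) G(y) in which one factor is a polynomial of degree at most r - 1,
   so by Fubini its integral against sigma x sigma vanishes when mu and nu have the same moments. *)

(** * Borel sets of the space of row vectors and measurability by coordinates *)

Section borel_sets.
Local Open Scope classical_set_scope.

(** Rational centres and radii [1/(k+1)] keep the family countable, so an open set is a countable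
    union of boxes. *)
Definition box (R : realType) (d : nat) (q : 'rV[rat]_d) (k : nat)
    : set 'rV[R]_d :=
  [set x | forall i, `|x ord0 i - ratr (q ord0 i)| < k.+1%:R^-1].

Lemma open_box_cover (R : realType) (d : nat) (U : set 'rV[R]_d) : open U ->
  U = \bigcup_(b : 'rV[rat]_d * nat)
        (if `[< box b.1 b.2 `<=` U >] then @box R d b.1 b.2 else set0).
Proof.
move=> oU; apply/seteqP; split=> x; last first.
  by move=> [[q k] _ /=]; case: asboolP => // + bx; apply.
move=> Ux.
have /nbhs_ballP[e e0 xeU] : nbhs x U by apply: open_nbhs_nbhs.
(* One half of [e] pays for the distance from [x] to the rational centre, the other for the distance
   from the centre to [y]. *)
have [k ke] : exists k : nat, k.+1%:R^-1 < e / 2.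
  have [k] := near_infty_natSinv_lt (PosNum (divr_gt0 e0 (@ltr0n R 2))).
  by move=> _ /(_ k (leqnn k)) /= h; exists k.
have /choice[q hq] : forall i : 'I_d, exists q : rat,
    `|x ord0 i - ratr q| < k.+1%:R^-1.
  move=> i.
  have k0 : (0 : R) < k.+1%:R^-1 by rewrite invr_gt0.
  have lt_x : x ord0 i - k.+1%:R^-1 < x ord0 i + k.+1%:R^-1.
    by rewrite ltrBlDr -addrA ltrDl addr_gt0.
  have [q] := rat_in_itvoo lt_x.
  by rewrite in_itv/= => /andP[q1 q2]; exists q; rewrite ltr_norml ltrNl opprB !ltrBlDl q2/= -ltrBlDr.
exists (\row_i q i, k) => //=.
case: asboolP; first by move=> _ i; rewrite mxE.
case=> y by_; apply: xeU; split=> // i j.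
rewrite (ord1 i); have := by_ j; rewrite mxE => yj; have xj := hq j.
rewrite -ball_normE /ball_ /=.
rewrite -(subrKA (ratr (q j))) (le_lt_trans (ler_normD _ _))//.
by rewrite (distrC (ratr _)) [e]splitr ltrD// (lt_trans _ ke).
Qed.

Lemma continuous_measurable_Rd (R : realType) (d : nat) (f : 'rV[R]_d -> R) :
  continuous f -> measurable_fun setT (f : @Rd R d -> R).
Proof.
move=> /continuousP cf.
apply: (@measurability _ _ _ _ _ _ _ (RGenOpens.measurableE R)).
move=> _ [_ [a [b ->] <-]]; rewrite setTI; apply: sub_sigma_algebra.
by apply: cf; exact: interval_open.
Qed.

Lemma measurable_coord (R : realType) (d : nat) (i : 'I_d) :
  measurable_fun setT (fun x : @Rd R d => x ord0 i : R).
Proof.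
apply: (@continuous_measurable_Rd R d (fun x => x ord0 i)).
exact: coord_continuous.
Qed.

(** Each open set is a countable union of boxes, and the preimage of a box is a finite intersection
    of preimages under coordinates. This is what makes [(x, y) |-> x - y] measurable for the product
    of the Borel sigma-algebras, where continuity alone does not apply directly. *)
Lemma measurable_fun_Rd (R : realType) (d : nat) (dT : measure_display)
    (T : measurableType dT) (g : T -> @Rd R d) :
  (forall i, measurable_fun setT (fun t => g t ord0 i : R)) ->
  measurable_fun setT g.
Proof.
move=> mg.
apply: (@measurability _ _ T (@Rd R d) setT g (@open 'rV[R]_d)) => //.
move=> _ [U oU <-]; rewrite setTI (open_box_cover oU) preimage_bigcup.
apply: countable_bigcupT_measurable; first exact: countableP.
move=> [q k] /=; case: asboolP => _; last by rewrite preimage_set0.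
have -> : g @^-1` box q k = \bigcap_(i : 'I_d)
    ((fun t => g t ord0 i : R) @^-1` ball (ratr (q ord0 i) : R) k.+1%:R^-1).
  apply/seteqP; split=> t /= h.
    by move=> i _ /=; rewrite -ball_normE /ball_ /= distrC; exact: h.
  by move=> i; have := h i I; rewrite /= -ball_normE /ball_ /= distrC.
apply: fin_bigcap_measurable; first exact: finite_finset.
move=> i _; rewrite -[X in measurable X]setTI; apply: mg => //.
exact: measurable_ball.
Qed.

End borel_sets.

(** * Polynomial growth measured by powers of [max(1, |x|)] *)

Section growth.
Context {R : realType} {d : nat}.
Implicit Types (x y : 'rV[R]_d) (f g : 'rV[R]_d -> R) (s t : R).

Definition weight s x : R := Num.max 1 (enorm x) `^ s.

Definition grows s f := exists2 M : R, 0 <= M & forall x, `|f x| <= M * weight s x.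

Lemma enorm_ge0 x : 0 <= enorm x. Proof. exact: sqrtr_ge0. Qed.

Lemma ge1_max_enorm x : 1 <= Num.max 1 (enorm x).
Proof. by rewrite le_max lexx. Qed.

Lemma weight_gt0 s x : 0 < weight s x.
Proof. by rewrite powR_gt0// (lt_le_trans ltr01)// ge1_max_enorm. Qed.

Lemma weightD s t x : weight (s + t) x = weight s x * weight t x.
Proof.
rewrite /weight powRD//; apply/implyP => _.
by rewrite gt_eqF// (lt_le_trans ltr01)// ge1_max_enorm.
Qed.

Lemma weight_le s t x : s <= t -> weight s x <= weight t x.
Proof. by move=> st; rewrite /weight ler_powR// ge1_max_enorm. Qed.

Lemma weight_ge1 s x : 0 <= s -> 1 <= weight s x.
Proof. by move=> s0; rewrite -(powRr0 (Num.max 1 (enorm x))) weight_le. Qed.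

Lemma weight_enorm s x : weight s x <= 1 + enorm x `^ s.
Proof.
rewrite /weight; case: (leP (enorm x) 1) => h.
  by rewrite powR1 lerDl powR_ge0.
by rewrite lerDr ler01.
Qed.

Lemma growsW s t f : s <= t -> grows s f -> grows t f.
Proof.
move=> st [M M0 h]; exists M => // x.
by rewrite (le_trans (h x))// ler_wpM2l// weight_le.
Qed.

Lemma growsD s f g : grows s f -> grows s g -> grows s (fun x => f x + g x).
Proof.
move=> [M M0 hf] [L L0 hg]; exists (M + L) => [|x]; first exact: addr_ge0.
by rewrite (le_trans (ler_normD _ _))// mulrDl lerD.
Qed.

Lemma growsM s t f g : grows s f -> grows t g ->
  grows (s + t) (fun x => f x * g x).
Proof.
move=> [M M0 hf] [L L0 hg]; exists (M * L) => [|x]; first exact: mulr_ge0.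
by rewrite normrM weightD mulrACA ler_pM.
Qed.

Lemma growsZ s c f : grows s f -> grows s (fun x => c * f x).
Proof.
move=> [M M0 hf]; exists (`|c| * M) => [|x]; first exact: mulr_ge0.
by rewrite normrM -mulrA ler_wpM2l.
Qed.

Lemma growsN s f : grows s f -> grows s (fun x => - f x).
Proof. by move=> [M M0 hf]; exists M => // x; rewrite normrN. Qed.

Lemma grows_sum s (I : Type) (r : seq I) (P : pred I) (F : I -> 'rV[R]_d -> R) :
  (forall i, P i -> grows s (F i)) ->
  grows s (fun x => \sum_(i <- r | P i) F i x).
Proof.
move=> gF; elim: r => [|i r [M M0 IH]].
  by exists 0 => // x; rewrite big_nil normr0 mul0r.
have [Pi|nPi] := boolP (P i); last first.
  by exists M => // x; rewrite big_cons (negPf nPi).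
have [L L0 hL] := growsD (gF _ Pi) (ex_intro2 _ _ M M0 IH).
by exists L => // x; rewrite big_cons Pi.
Qed.

Lemma coord_le_enorm x i : `|x ord0 i| <= enorm x.
Proof.
rewrite -sqrtr_sqr ler_wsqrtr// (bigD1 i)//= lerDl sumr_ge0// => j _.
exact: sqr_ge0.
Qed.

(** Every coordinate is at most [max(1, |x|)], and this base being at least 1 lets the total degree
    be raised to [n]. *)
Lemma monomial_grows (a : 'I_d -> nat) (n : nat) : (\sum_i a i <= n)%N ->
  grows n%:R (monomial a).
Proof.
move=> an; exists 1 => // x; rewrite mul1r /monomial normr_prod.
rewrite (@le_trans _ _ (weight (\sum_i a i)%:R x))//; last first.
  by rewrite weight_le// ler_nat.
rewrite /weight powR_mulrn; last by rewrite (le_trans ler01)// ge1_max_enorm.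
rewrite -prodrXr; apply: ler_prod => i _.
rewrite normr_ge0/= normrX lerXn2r ?nnegrE//.
  by rewrite (le_trans ler01)// ge1_max_enorm.
by rewrite (le_trans (coord_le_enorm _ _))// le_max lexx orbT.
Qed.

Lemma poly_grows n f : poly_le n f -> grows n%:R f.
Proof.
move=> [c fE].
have [M M0 h] : grows n%:R (fun x =>
    \sum_(a : {ffun 'I_d -> 'I_n.+1} | (\sum_i (a i : nat) <= n)%N)
      c a * monomial (fun i => a i) x).
  by apply: grows_sum => a an; apply/growsZ/monomial_grows.
by exists M => // x; rewrite fE.
Qed.

(** With [a] and [b] the two maxima, [|x - y|^2 <= 2 |x|^2 + 2 |y|^2 <= 2 a^2 + 2 b^2 <= 4 a^2 b^2].
    The first inequality is coordinatewise [(x_i + y_i)^2 >= 0], and the last uses [a, b >= 1]. *)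
Lemma enormB_le x y :
  enorm (x - y) <= 2 * (Num.max 1 (enorm x) * Num.max 1 (enorm y)).
Proof.
set a := Num.max _ _; set b := Num.max _ _.
have a1 : 1 <= a := ge1_max_enorm x.
have b1 : 1 <= b := ge1_max_enorm y.
have ea : \sum_i x ord0 i ^+ 2 <= a ^+ 2.
  have s0 : 0 <= \sum_i x ord0 i ^+ 2 by apply: sumr_ge0 => i _; exact: sqr_ge0.
  rewrite -(sqr_sqrtr s0) lerXn2r ?nnegrE ?sqrtr_ge0//.
    exact: (le_trans ler01 a1).
  by rewrite le_max lexx orbT.
have eb : \sum_i y ord0 i ^+ 2 <= b ^+ 2.
  have s0 : 0 <= \sum_i y ord0 i ^+ 2 by apply: sumr_ge0 => i _; exact: sqr_ge0.
  rewrite -(sqr_sqrtr s0) lerXn2r ?nnegrE ?sqrtr_ge0//.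
    exact: (le_trans ler01 b1).
  by rewrite le_max lexx orbT.
have ab0 : 0 <= 2 * (a * b) by rewrite !mulr_ge0//; lra.
rewrite -(ger0_norm ab0) -sqrtr_sqr ler_wsqrtr//.
apply: (@le_trans _ _ (2 * a ^+ 2 + 2 * b ^+ 2)); last first.
  have a2 : 1 <= a ^+ 2 by rewrite exprn_ege1.
  have b2 : 1 <= b ^+ 2 by rewrite exprn_ege1.
  rewrite !exprMn; nra.
apply: (@le_trans _ _ (2 * (\sum_i x ord0 i ^+ 2) + 2 * (\sum_i y ord0 i ^+ 2)));
  last by lra.
rewrite !mulr_sumr -big_split ler_sum//= => i _; rewrite !mxE.
by have := sqr_ge0 (x ord0 i + y ord0 i); lra.
Qed.

Lemma weightB_bound (Phi : 'rV[R]_d -> R) alpha C : 0 < alpha ->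
  (forall x, `|Phi x| <= C * (1 + enorm x `^ alpha)) ->
  exists2 L, 0 <= L &
    forall x y, `|Phi (x - y)| <= L * (weight alpha x * weight alpha y).
Proof.
move=> a0 hPhi.
(* The growth bound at the origin already forces the sign of [C]. *)
have C0 : 0 <= C.
  have := le_trans (normr_ge0 _) (hPhi 0).
  by rewrite pmulr_lge0// ltr_pwDl// powR_ge0.
(* The summand 1 is at most the product of the weights, and [enormB_le] raised to the power [alpha]
   contributes the factor [2^alpha]. *)
exists (C * (1 + 2 `^ alpha)) => [|x y].
  by rewrite mulr_ge0// addr_ge0// powR_ge0.
rewrite (le_trans (hPhi _))// -mulrA ler_wpM2l// mulrDl lerD//.
  by rewrite mul1r mulr_ege1// weight_ge1// ltW.
rewrite /weight -!powRM ?ge0_ler_powR ?nnegrE ?enorm_ge0 ?enormB_le//.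
all: rewrite ?mulr_ge0//; try exact: ltW.
all: exact: (le_trans ler01 (ge1_max_enorm _)).
Qed.

Lemma grows_shiftl (Phi : 'rV[R]_d -> R) alpha C (z : 'rV[R]_d) : 0 < alpha ->
  (forall x, `|Phi x| <= C * (1 + enorm x `^ alpha)) ->
  grows alpha (fun x => Phi (z - x)).
Proof.
move=> a0 hPhi; have [L L0 hL] := weightB_bound a0 hPhi.
exists (L * weight alpha z) => [|x]; last by rewrite -mulrA.
by rewrite mulr_ge0// ltW// weight_gt0.
Qed.

Lemma grows_shiftr (Phi : 'rV[R]_d -> R) alpha C (z : 'rV[R]_d) : 0 < alpha ->
  (forall x, `|Phi x| <= C * (1 + enorm x `^ alpha)) ->
  grows alpha (fun x => Phi (x - z)).
Proof.
move=> a0 hPhi; have [L L0 hL] := weightB_bound a0 hPhi.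
exists (L * weight alpha z) => [|x]; last by rewrite -mulrA [weight _ z * _]mulrC.
by rewrite mulr_ge0// ltW// weight_gt0.
Qed.

End growth.

(** * The kernel [Kred]: positivity and bounds *)

Section reduced_kernel.
Context {R : realType} {d : nat}.
Implicit Types (x y : 'rV[R]_d) (f g h : 'rV[R]_d -> R) (s t : R).
Variables (N : nat) (xi : 'I_N -> 'rV[R]_d) (pl : 'I_N -> 'rV[R]_d -> R).

(* The value at h of the functional delta_x - sum_j p_j(x) delta_(xi_j), which annihilates polynomials. *)
Definition resid x h : R := h x - \sum_j pl j x * h (xi j).

Lemma KredE Phi x y :
  Kred Phi xi pl x y = resid x (fun u => resid y (fun v => Phi (u - v))).
Proof.
rewrite /Kred /resid.
under [X in _ = _ - X]eq_bigr do rewrite mulrBr.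
rewrite sumrB opprB addrA [in RHS]addrAC.
rewrite -!addrA; congr (_ + _); rewrite addrCA; congr (_ + _).
congr (_ + _); apply: eq_bigr => j _.
by rewrite mulr_sumr; apply: eq_bigr => k _; rewrite mulrA.
Qed.

Lemma resid_lin x s t f g :
  resid x (fun u => s * f u + t * g u) = s * resid x f + t * resid x g.
Proof.
rewrite /resid !mulrBr addrACA -opprD !mulr_sumr -big_split/=; congr (_ - _).
by apply: eq_bigr => j _; ring.
Qed.

Lemma poly_leZD n s f g : poly_le n f -> poly_le n g ->
  poly_le n (fun x => s * f x + g x).
Proof.
move=> [c fE] [e gE]; exists (fun a => s * c a + e a) => x.
rewrite fE gE mulr_sumr -big_split; apply: eq_bigr => a _ /=.
by rewrite mulrDl mulrA.
Qed.

Lemma poly_le_sum n (I : Type) (r : seq I) (c : I -> R)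
    (F : I -> 'rV[R]_d -> R) : (forall i, poly_le n (F i)) ->
  poly_le n (fun x => \sum_(i <- r) c i * F i x).
Proof.
move=> pF; elim: r => [|i r [e IH]].
  exists (fun=> 0) => x; rewrite big_nil big1// => a _; exact: mul0r.
have [e' h] := poly_leZD (c i) (pF i) (ex_intro _ e IH).
by exists e' => x; rewrite big_cons h.
Qed.

(** The difference between [p] and its Lagrange interpolant is again a polynomial of the same degree
    bound and vanishes at every [xi k], so unisolvence makes it zero. *)
Lemma resid_poly r p : unisolvent r xi -> lagrange_basis r xi pl ->
  poly_le r.-1 p -> forall x, resid x p = 0.
Proof.
move=> uni [ppl lag] pp x.
suff h : forall x, -1 * (\sum_j p (xi j) * pl j x) + p x = 0.
  rewrite /resid -[RHS](h x) addrC; congr (_ + _).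
  by rewrite mulN1r; congr (- _); apply: eq_bigr => j _; rewrite mulrC.
apply: uni => [|k]; first by apply: poly_leZD => //; exact: poly_le_sum.
rewrite (bigD1 k)//= lag eqxx big1 => [|j jk].
  by rewrite mulr1 addr0 mulN1r addNr.
by rewrite lag (negPf jk) mulr0.
Qed.

(** Real coefficients equal their conjugates, so the Hermitian form is the embedding of a real one.
    The nested shape of the sum lets a discrete functional be recognised first in the inner and then
    in the outer variable. *)
Lemma CP_real r Phi M (z : 'I_M -> 'rV[R]_d) (a : 'I_M -> R) :
  CP r Phi -> (exists j, a j != 0) ->
  (forall p, poly_le r.-1 p -> \sum_j a j * p (z j) = 0) ->
  0 <= \sum_j a j * \sum_k a k * Phi (z j - z k).
Proof.
move=> [_ _ pd] [j aj0] ap0.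
have := @pd M z (fun j => (a j)%:C%C).
have -> : \sum_j \sum_k (a j)%:C%C * ((a k)%:C^*)%C * (Phi (z j - z k))%:C%C =
          ((\sum_j a j * \sum_k a k * Phi (z j - z k))%:C)%C.
  rewrite rmorph_sum; apply: eq_bigr => i _.
  rewrite rmorphM rmorph_sum mulr_sumr; apply: eq_bigr => k _.
  by rewrite rmorphM mulrA conjc_real.
rewrite lecR; apply.
  by exists j; rewrite fmorph_eq0.
move=> p pp; transitivity ((\sum_i a i * p (z i))%:C)%C; last first.
  by rewrite ap0.
by rewrite rmorph_sum; apply: eq_bigr => i _; rewrite rmorphM.
Qed.

Definition fcons (T : Type) (n : nat) (a : T) (F : 'I_n -> T) (i : 'I_n.+1) : T :=
  if unlift ord0 i is Some j then F j else a.

Lemma fcons0 (T : Type) n (a : T) (F : 'I_n -> T) : fcons a F ord0 = a.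
Proof. by rewrite /fcons unlift_none. Qed.

Lemma fconsS (T : Type) n (a : T) (F : 'I_n -> T) j : fcons a F (lift ord0 j) = F j.
Proof. by rewrite /fcons liftK. Qed.

(** The form is [Phi] tested against the functional [s * resid x + t * resid y], which kills
    polynomials. The condition [s != 0] makes the coefficient vector nonzero; the points may
    coincide, since [CP] does not ask for distinct ones. *)
Lemma Kred_psd r Phi x y s t : CP r Phi -> unisolvent r xi ->
  lagrange_basis r xi pl -> s != 0 ->
  0 <= s ^+ 2 * Kred Phi xi pl x x + 2 * s * t * Kred Phi xi pl x y
       + t ^+ 2 * Kred Phi xi pl y y.
Proof.
move=> cp uni lag s0.
pose z := fcons x (fcons y xi).
(* The coefficients at the [xi j] are those that the two residual functionals put there. *)
pose a := fcons s (fcons t (fun j => - (s * pl j x + t * pl j y))).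
have aE h : \sum_i a i * h (z i) = s * resid x h + t * resid y h.
  rewrite !big_ord_recl /a /z !fcons0 !fconsS !fcons0 /resid !mulrBr.
  rewrite addrACA -opprD addrA; congr (_ + _).
  rewrite !mulr_sumr -big_split -sumrN; apply: eq_bigr => j _.
  by rewrite !fconsS/=; ring.
have Ksym : Kred Phi xi pl y x = Kred Phi xi pl x y.
  have [_ even _] := cp.
  have Phi_sym u v : Phi (u - v) = Phi (v - u) by rewrite -even opprB.
  rewrite /Kred (Phi_sym y x); congr (_ + _).
    rewrite [LHS]addrAC; congr (_ - _ - _).
      by apply: eq_bigr => j _; rewrite Phi_sym.
    by apply: eq_bigr => j _; rewrite Phi_sym.
  rewrite exchange_big; apply: eq_bigr => j _; apply: eq_bigr => k _.
    by rewrite Phi_sym [pl _ y * _]mulrC.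
have := @CP_real r Phi _ z a cp.
(* [aE] evaluates the inner sum here and the outer sum next; linearity of [resid] then leaves the
   quadratic form in [s] and [t]. *)
under eq_bigr do rewrite (aE (fun v => Phi (_ - v))).
rewrite (aE (fun u => s * resid x (fun v => Phi (u - v)) +
                      t * resid y (fun v => Phi (u - v)))).
rewrite !resid_lin -!KredE Ksym.
set Kxx := Kred _ _ _ x x; set Kxy := Kred _ _ _ x y; set Kyy := Kred _ _ _ y y.
have -> : s * (s * Kxx + t * Kxy) + t * (s * Kxy + t * Kyy) =
  s ^+ 2 * Kxx + 2 * s * t * Kxy + t ^+ 2 * Kyy by ring.
apply.
  by exists ord0; rewrite /a fcons0.
by move=> p pp; rewrite aE !(resid_poly uni lag pp) !mulr0 addr0.
Qed.

(** The two diagonal terms add up to at most [2 M u^2 v^2], so [2 u v |K(x, y)| <= 2 M u^2 v^2];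
    dividing by [2 u v] needs no square root and no separate case for a vanishing diagonal. *)
Lemma Kred_CS r Phi x y (u v M : R) : CP r Phi -> unisolvent r xi ->
  lagrange_basis r xi pl -> 0 < u -> 0 < v ->
  Kred Phi xi pl x x <= M * u ^+ 2 -> Kred Phi xi pl y y <= M * v ^+ 2 ->
  `|Kred Phi xi pl x y| <= M * (u * v).
Proof.
move=> cp uni lag u0 v0 hx hy.
(* Positivity with coefficients (v, u) and (v, -u) balances the two diagonal terms. *)
have v0' : v != 0 by rewrite gt_eqF.
have hp := Kred_psd x y u cp uni lag v0'.
have hm := Kred_psd x y (- u) cp uni lag v0'.
move: hp hm hx hy.
set Kxx := Kred _ _ _ x x; set Kxy := Kred _ _ _ x y; set Kyy := Kred _ _ _ y y.
move=> hp hm hx hy.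
have hx' := ler_wpM2l (ltW (exprn_gt0 2 v0)) hx.
have hy' := ler_wpM2l (ltW (exprn_gt0 2 u0)) hy.
have uv0 : 0 < 2 * (u * v) by rewrite !mulr_gt0.
rewrite ler_norml -(ler_pM2l uv0) -[X in _ && X](ler_pM2l uv0).
by apply/andP; split; lra.
Qed.

(** This is the origin of [beta]: on the diagonal the first term is the constant [Phi 0], the two
    mixed sums grow with exponent [r - 1 + alpha], and the double sum with exponent [2 (r - 1)].
    Twice [beta] dominates them all. *)
Lemma Kred_diag_grows r Phi alpha C : 0 < alpha ->
  (forall x, `|Phi x| <= C * (1 + enorm x `^ alpha)) ->
  lagrange_basis r xi pl ->
  let beta : R := Num.max (r.-1)%:R (((r.-1)%:R + alpha) / 2) in
  grows (beta + beta) (fun x => Kred Phi xi pl x x).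
Proof.
move=> a0 hPhi [ppl _] beta.
have r0 : (0 : R) <= (r.-1)%:R by rewrite ler0n.
have hb1 : (r.-1)%:R <= beta by rewrite /beta le_max lexx.
have hb2 : ((r.-1)%:R + alpha) / 2 <= beta by rewrite /beta le_max lexx orbT.
have hb : (r.-1)%:R + alpha <= beta + beta by lra.
have b0 : 0 <= beta + beta by lra.
have Phi_l := fun z => grows_shiftl z a0 hPhi; have Phi_r := fun z => grows_shiftr z a0 hPhi.
rewrite /Kred; apply: growsD; last first.
  apply: grows_sum => j _; apply: grows_sum => k _.
  apply: (@growsW _ _ ((r.-1)%:R + (r.-1)%:R)); first exact: lerD.
  have [M M0 h] := growsZ (Phi (xi j - xi k))
    (growsM (poly_grows (ppl j)) (poly_grows (ppl k))).
  by exists M => // x; rewrite mulrC.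
apply: growsD; last first.
  apply/growsN/grows_sum => j _; apply: (growsW hb).
  exact: growsM (poly_grows (ppl j)) (Phi_r _).
apply: growsD; last first.
  apply/growsN/grows_sum => j _; apply: (growsW hb).
  exact: growsM (poly_grows (ppl j)) (Phi_l _).
exists `|Phi 0| => // x; rewrite subrr.
by rewrite ler_peMr// weight_ge1.
Qed.

Lemma Kred_bound r Phi alpha C : 0 < alpha -> CP r Phi ->
  (forall x, `|Phi x| <= C * (1 + enorm x `^ alpha)) ->
  unisolvent r xi -> lagrange_basis r xi pl ->
  let beta : R := Num.max (r.-1)%:R (((r.-1)%:R + alpha) / 2) in
  exists2 M, 0 <= M &
    forall x y, `|Kred Phi xi pl x y| <= M * (weight beta x * weight beta y).
Proof.
move=> a0 cp hPhi uni lag beta.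
have [M M0 h] := Kred_diag_grows a0 hPhi lag.
exists M => // x y.
by apply: (Kred_CS cp uni lag); rewrite ?weight_gt0// expr2 -weightD;
  exact: le_trans (ler_norm _) (h _).
Qed.

End reduced_kernel.

(** * Jordan parts of a difference of signed measures *)

Section signed_measures.
Local Open Scope classical_set_scope.
Local Open Scope ereal_scope.
Context {R : realType} {dT : measure_display} {T : measurableType dT}.
Implicit Types (mu nu sg : {charge set T -> \bar R}) (A : set T).


Lemma cvarE sg A : cvar sg A = cpos sg A + cneg sg A.
Proof. by []. Qed.

Lemma cposE sg A : measurable A -> cpos sg A = sg (A `&` (hahnPN sg).1).
Proof.
by move=> mA; rewrite /cpos jordan_posE charge.cjordan_posE /crestr0 mem_set.
Qed.

Lemma cnegE sg A : measurable A -> cneg sg A = - sg (A `&` (hahnPN sg).2).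
Proof.
by move=> mA; rewrite /cneg jordan_negE charge.cjordan_negE /crestr0 mem_set.
Qed.

Lemma cvar_fin sg : fin_num_fun (cvar sg).
Proof. by move=> A mA; rewrite cvarE fin_numD !fin_num_measure. Qed.

(** The variation packaged as a finite measure, the form in which the product-integral lemmas take
    it. *)
Definition finite_cvar sg : {finite_measure set T -> \bar R} :=
  HB.pack_for {finite_measure set T -> \bar R} (cvar sg)
    (Measure.on (cvar sg)) (Measure_isFinite.Build _ _ _ (cvar sg) (cvar_fin sg)).


Lemma integrable_le_measure (m1 m2 : {measure set T -> \bar R}) (f : T -> \bar R) :
  (forall A, measurable A -> m1 A <= m2 A) ->
  m2.-integrable setT f -> m1.-integrable setT f.
Proof.
move=> m12 /integrableP[mf foo]; apply/integrableP; split=> //.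
apply: le_lt_trans foo; apply: ge0_le_measure_integral => //.
exact: measurableT_comp.
Qed.

Lemma cpos_le_cvar sg A : cpos sg A <= cvar sg A.
Proof. by rewrite cvarE leeDl. Qed.

Lemma cneg_le_cvar sg A : cneg sg A <= cvar sg A.
Proof. by rewrite cvarE leeDr. Qed.

Lemma abse_cvar sg A : measurable A -> `|sg A| <= cvar sg A.
Proof. exact: abse_charge_variation. Qed.

(** Negative parts move to the other side, so that each side becomes the value of a sum of positive
    measures; [fin_num_cancel] undoes this after integration. *)
Lemma fin_num_balance (p n a b c e : \bar R) :
  p \is a fin_num -> n \is a fin_num -> a \is a fin_num ->
  b \is a fin_num -> c \is a fin_num -> e \is a fin_num ->
  p - n = a - b - (c - e) -> p + (b + c) = n + (a + e).
Proof.
case: p n a b c e => [p| |] [n| |] [a| |] [b| |] [c| |] [e| |] //.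
by move=> _ _ _ _ _ _ [h]; congr (_%:E); lra.
Qed.

Lemma fin_num_cancel (p n a b c e : \bar R) :
  p \is a fin_num -> n \is a fin_num -> a \is a fin_num ->
  b \is a fin_num -> c \is a fin_num -> e \is a fin_num ->
  p + (b + c) = n + (a + e) -> a - b = c - e -> p = n.
Proof.
case: p n a b c e => [p| |] [n| |] [a| |] [b| |] [c| |] [e| |] //.
by move=> _ _ _ _ _ _ [h] [k]; congr (_%:E); lra.
Qed.

Section difference.
Variables (mu nu : {charge set T -> \bar R}).
Let sg : {charge set T -> \bar R} := cadd mu (copp nu).

Lemma abse_diff A : measurable A ->
  `|sg A| <= measure_add (cvar mu) (cvar nu) A.
Proof.
move=> mA; rewrite measure_addE (le_trans (lee_abs_add _ _))//.
by rewrite abseN leeD// abse_cvar.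
Qed.

Let measurable_hahn1 : measurable (hahnPN sg).1.
Proof. by have [[]] := hahnP sg. Qed.

Let measurable_hahn2 : measurable (hahnPN sg).2.
Proof. by have [_ []] := hahnP sg. Qed.

(** The Jordan parts of [mu - nu] are not built from those of [mu] and [nu], but on the Hahn set [P]
    the value [sg (A & P)] is at most [(|mu| + |nu|)(A & P)], hence at most [(|mu| + |nu|)(A)]. *)
Lemma cpos_diff_le A : measurable A ->
  cpos sg A <= measure_add (cvar mu) (cvar nu) A.
Proof.
move=> mA; have mAP : measurable (A `&` (hahnPN sg).1) by exact: measurableI.
rewrite cposE//.
apply: (le_trans (lee_abs _)); apply: (le_trans (abse_diff mAP)).
by apply: le_measure; rewrite ?inE.
Qed.

Lemma cneg_diff_le A : measurable A ->
  cneg sg A <= measure_add (cvar mu) (cvar nu) A.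
Proof.
move=> mA; have mAN : measurable (A `&` (hahnPN sg).2) by exact: measurableI.
rewrite cnegE//.
apply: (le_trans (lee_abs _)); rewrite abseN; apply: (le_trans (abse_diff mAN)).
by apply: le_measure; rewrite ?inE.
Qed.

Lemma integrable_diff (f : T -> \bar R) :
  (cvar mu).-integrable setT f -> (cvar nu).-integrable setT f ->
  [/\ (cpos sg).-integrable setT f, (cneg sg).-integrable setT f &
      (cvar sg).-integrable setT f].
Proof.
move=> /integrableP[mf muf] /integrableP[_ nuf].
have maf : measurable_fun setT (abse \o f) by exact: measurableT_comp.
have iadd : (measure_add (cvar mu) (cvar nu)).-integrable setT f.
  apply/integrableP; split=> //.
  by rewrite ge0_integral_measure_add// lte_add_pinfty.
have ip := integrable_le_measure cpos_diff_le iadd.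
have ine := integrable_le_measure cneg_diff_le iadd.
split=> //; apply/integrableP; split=> //.
rewrite (@eq_measure_integral _ _ _ _ (measure_add (cpos sg) (cneg sg))); last first.
  by move=> A mA _; exact: (esym (measure_addE (cpos sg) (cneg sg) A)).
rewrite ge0_integral_measure_add//.
by apply: lte_add_pinfty; [case/integrableP: ip|case/integrableP: ine].
Qed.

(** With [sg = mu - nu], the measures [sg^+ + mu^- + nu^+] and [sg^- + mu^+ + nu^-] coincide.
    Integrating [f] against both and cancelling the equal integrals over [mu] and [nu] gives the
    claim; integrability keeps every term finite. *)
Lemma cpos_cneg_integral_eq (f : T -> \bar R) :
  (cvar mu).-integrable setT f -> (cvar nu).-integrable setT f ->
  cintegral mu f = cintegral nu f ->
  \int[cpos sg]_x f x = \int[cneg sg]_x f x.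
Proof.
move=> muf nuf; have [ip ine _] := integrable_diff muf nuf.
have ipm : (cpos mu).-integrable setT f.
  by apply: integrable_le_measure muf => A _; exact: cpos_le_cvar.
have inm : (cneg mu).-integrable setT f.
  by apply: integrable_le_measure muf => A _; exact: cneg_le_cvar.
have ipn : (cpos nu).-integrable setT f.
  by apply: integrable_le_measure nuf => A _; exact: cpos_le_cvar.
have inn : (cneg nu).-integrable setT f.
  by apply: integrable_le_measure nuf => A _; exact: cneg_le_cvar.
have iadd (m1 m2 : {measure set T -> \bar R}) : m1.-integrable setT f ->
    m2.-integrable setT f -> (measure_add m1 m2).-integrable setT f.
  move=> /integrableP[mf h1] /integrableP[_ h2]; apply/integrableP; split=> //.
  have maf : measurable_fun setT (abse \o f) by exact: measurableT_comp.
  by rewrite ge0_integral_measure_add// lte_add_pinfty.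
have : \int[measure_add (cpos sg) (measure_add (cneg mu) (cpos nu))]_x f x =
       \int[measure_add (cneg sg) (measure_add (cpos mu) (cneg nu))]_x f x.
  apply: eq_measure_integral => A mA _.
  have addE (m1 m2 : {measure set T -> \bar R}) :
    (measure_add m1 m2 : {measure set T -> \bar R}) A = m1 A + m2 A.
    exact: measure_addE.
  rewrite !addE.
  have jd (c : {charge set T -> \bar R}) : c A = cpos c A - cneg c A.
    by rewrite (jordan_decomp (hahnP c) mA) /cadd/= cscaleN1.
  have : cpos sg A - cneg sg A =
      (cpos mu A - cneg mu A) - (cpos nu A - cneg nu A).
    by rewrite -!jd.
  have fp (c : {charge set T -> \bar R}) : cpos c A \is a fin_num by rewrite fin_num_measure.
  have fn (c : {charge set T -> \bar R}) : cneg c A \is a fin_num by rewrite fin_num_measure.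
  by apply: fin_num_balance; rewrite ?fp ?fn.
rewrite !integral_measure_add//; [|exact: iadd..].
by apply: fin_num_cancel; exact: integrable_fin_num.
Qed.

End difference.
End signed_measures.

(** * Integrals over products of the Jordan parts *)

Section product_integrals.
Local Open Scope classical_set_scope.
Local Open Scope ereal_scope.
Context {R : realType} {dT : measure_display} {T : measurableType dT}.

Section tensor.
Variables (m1 m2 : {finite_measure set T -> \bar R}) (F G : T -> R).
Hypotheses (iF : m1.-integrable setT (EFin \o F))
  (iG : m2.-integrable setT (EFin \o G)).
Let f (z : T * T) := (F z.1 * G z.2)%:E.

(** By Tonelli the integral of [|F(x) G(y)|] is the product of two finite integrals. *)
Lemma integrable_tensor : (m1 \x m2).-integrable setT f.
Proof.
have mF : measurable_fun setT F by apply/measurable_EFinP/(measurable_int m1).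
have mG : measurable_fun setT G by apply/measurable_EFinP/(measurable_int m2).
apply/integrable12ltyP.
  apply/measurable_EFinP/measurable_funM.
    exact: measurableT_comp.
  exact: measurableT_comp.
have G_fin : \int[m2]_y `|(G y)%:E| \is a fin_num.
  exact: (integrable_fin_num measurableT (integrable_abse iG)).
under eq_integral => x _.
  under eq_integral => y _ do rewrite /f/= normrM EFinM.
  rewrite ge0_integralZl//; last first.
    by apply/measurable_EFinP; exact: measurableT_comp.
  over.
rewrite ge0_integralZr//.
- rewrite lte_mul_pinfty//; first exact: integral_ge0.
    exact: (integrable_fin_num measurableT (integrable_abse iF)).
  by rewrite ltey_eq G_fin.
- by apply/measurable_EFinP; exact: measurableT_comp.
- exact: integral_ge0.
Qed.

Lemma integral_tensor : \int[m1 \x m2]_z f z =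
  \int[m1]_x (F x)%:E * \int[m2]_y (G y)%:E.
Proof.
rewrite -(integral12_prod_meas1 integrable_tensor).
have G_fin : \int[m2]_y (G y)%:E \is a fin_num by exact: integrable_fin_num.
rewrite -(fineK G_fin) -integralZr//; apply: eq_integral => x _.
rewrite /fubini_F (fineK G_fin) /f/=.
under eq_integral do rewrite EFinM.
by rewrite integralZl.
Qed.

End tensor.

Lemma integrable_tensor_bound (m1 m2 : {finite_measure set T -> \bar R})
    (w : T -> R) (f : T * T -> R) (M : R) :
  measurable_fun setT f ->
  m1.-integrable setT (EFin \o w) -> m2.-integrable setT (EFin \o w) ->
  (forall z, `|f z| <= M * (w z.1 * w z.2))%R ->
  (m1 \x m2).-integrable setT (EFin \o f).
Proof.
move=> mf w1 w2 fw.
apply: (le_integrable measurableT (g := fun z => (M * (w z.1 * w z.2))%:E)).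
- exact/measurable_EFinP.
- by move=> z _ /=; rewrite lee_fin (le_trans (fw z))// ler_norm.
- have := integrableZl measurableT M (integrable_tensor w1 w2).
  by apply: eq_integrable.
Qed.

Section signed.
Variable sg : {charge set T -> \bar R}.

(** Indexing the Jordan parts by a boolean treats the four product measures in [cintegral2]
    uniformly. *)
Definition cpart (b : bool) : {finite_measure set T -> \bar R} :=
  if b then (cpos sg : {finite_measure set T -> \bar R}) else cneg sg.

Definition cintegrable2 (f : T * T -> R) :=
  forall b1 b2, (cpart b1 \x cpart b2).-integrable setT (EFin \o f).

Lemma cintegral2D (f g : T * T -> R) : cintegrable2 f -> cintegrable2 g ->
  cintegral2 sg (fun z => (f z + g z)%:E) =
  cintegral2 sg (EFin \o f) + cintegral2 sg (EFin \o g).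
Proof.
move=> i_f i_g.
have D b1 b2 : \int[cpart b1 \x cpart b2]_z (f z + g z)%:E =
    \int[cpart b1 \x cpart b2]_z (f z)%:E + \int[cpart b1 \x cpart b2]_z (g z)%:E.
  under eq_integral do rewrite EFinD.
  by rewrite integralD//; [exact: i_f|exact: i_g].
have Ff b1 b2 := integrable_fin_num measurableT (i_f b1 b2).
have Fg b1 b2 := integrable_fin_num measurableT (i_g b1 b2).
rewrite /cintegral2.
rewrite (D true true) (D true false) (D false true) (D false false).
move: (Ff true true) (Ff true false) (Ff false true) (Ff false false).
move: (Fg true true) (Fg true false) (Fg false true) (Fg false false).
rewrite /cpart /=.
(* Two functions on four product measures give eight finite integrals; once all are real numbers,
   [ring] applies. *)
do 8 (move/fineK => <-).
by rewrite -!(EFinD, EFinN); congr (_%:E); ring.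
Qed.

Definition null2 (f : T * T -> R) :=
  cintegrable2 f /\ cintegral2 sg (EFin \o f) = 0.

Lemma null2D (f g : T * T -> R) : null2 f -> null2 g ->
  null2 (fun z => f z + g z)%R.
Proof.
move=> [i_f f0] [i_g g0]; split; last by rewrite cintegral2D// f0 g0 adde0.
by move=> b1 b2; apply: (integrableD measurableT (i_f b1 b2) (i_g b1 b2)).
Qed.

Lemma null2_sum n (F : 'I_n -> T * T -> R) : (forall i, null2 (F i)) ->
  null2 (fun z => \sum_i F i z)%R.
Proof.
move=> nF.
have -> : (fun z => \sum_i F i z)%R = (\sum_(i < n) F i)%R.
  by apply/funext => z; rewrite fct_sumE.
apply: (big_ind (fun f => null2 f)) => //; last by move=> f g; exact: null2D.
split; first by move=> b1 b2; exact: integrable0.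
by rewrite /cintegral2 !integral0 !sube0 adde0.
Qed.

(** Fubini factors the signed double integral as the product of the [F]-difference and the
    [G]-difference over the Jordan parts, so one vanishing difference suffices. *)
Lemma null2_tensor (F G : T -> R) :
  (forall b, (cpart b).-integrable setT (EFin \o F)) ->
  (forall b, (cpart b).-integrable setT (EFin \o G)) ->
  \int[cpos sg]_x (F x)%:E = \int[cneg sg]_x (F x)%:E \/
  \int[cpos sg]_x (G x)%:E = \int[cneg sg]_x (G x)%:E ->
  null2 (fun z => F z.1 * G z.2)%R.
Proof.
move=> iF iG eFG; split.
  by move=> b1 b2; exact: (integrable_tensor (iF b1) (iG b2)).
rewrite /cintegral2.
have I b1 b2 := integral_tensor (iF b1) (iG b2).
rewrite (I true true) (I true false) (I false true) (I false false) /cpart/=.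
move: (integrable_fin_num measurableT (iF true))
  (integrable_fin_num measurableT (iF false))
  (integrable_fin_num measurableT (iG true))
  (integrable_fin_num measurableT (iG false)) eFG.
rewrite /cpart /=.
do 4 (move/fineK => <-).
by case=> -[->]; rewrite -!(EFinM, EFinD, EFinN); congr (_%:E); ring.
Qed.

End signed.
End product_integrals.

(** * Moment conditions and integrability of functions of controlled growth *)

Section moments.
Local Open Scope classical_set_scope.
Context {R : realType} {d : nat}.
Implicit Types (mu nu : {charge set @Rd R d -> \bar R}) (f : 'rV[R]_d -> R).

Lemma measurable_enorm : measurable_fun setT (@enorm R d : @Rd R d -> R).
Proof.
apply: (measurableT_comp (continuous_measurable_fun (@sqrt_continuous R))).
apply: measurable_sum => i; apply: measurable_funX; exact: measurable_coord.
Qed.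

Lemma measurable_weight s : measurable_fun setT (@weight R d s : @Rd R d -> R).
Proof.
apply: (measurableT_comp (measurable_powR s)
  (g := fun x : @Rd R d => Num.max 1 (enorm x))).
by apply: measurable_maxr => //; exact: measurable_enorm.
Qed.

Lemma poly_measurable n (p : 'rV[R]_d -> R) : poly_le n p ->
  measurable_fun setT (p : @Rd R d -> R).
Proof.
move=> [c pE].
have -> : p = fun x => \sum_(a : {ffun 'I_d -> 'I_n.+1} |
    (\sum_i (a i : nat) <= n)%N) c a * monomial (fun i => a i) x.
  exact/funext.
(* The degree condition goes into the index list, leaving an unconditional sum for
   [measurable_sum]. *)
under eq_fun do rewrite -big_filter.
apply: measurable_sum => a; apply: measurable_funM => //.
apply: measurable_prod => i _; apply: measurable_funX; exact: measurable_coord.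
Qed.

Lemma measurable_subRd :
  measurable_fun setT (fun z : @Rd R d * @Rd R d => (z.1 - z.2 : @Rd R d)).
Proof.
apply: measurable_fun_Rd => i.
under eq_fun do rewrite !mxE.
apply: measurable_funB.
  exact: (measurableT_comp (measurable_coord i) measurable_fst).
exact: (measurableT_comp (measurable_coord i) measurable_snd).
Qed.

(** The weight is at most [1 + |x|^gamma]; the constant is integrable because the variation is
    finite. *)
Lemma Mmom_weight gamma mu : 0 <= gamma -> Mmom gamma mu ->
  (cvar mu).-integrable setT (EFin \o @weight R d gamma).
Proof.
move=> g0 momg.
have mpow : measurable_fun setT (fun x : @Rd R d => enorm x `^ gamma).
  exact: (measurableT_comp (measurable_powR gamma) measurable_enorm).
have i1 : (finite_cvar mu).-integrable setT (EFin \o cst 1).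
  exact: finite_measure_integrable_cst.
have i2 : (finite_cvar mu).-integrable setT (fun x : @Rd R d => (enorm x `^ gamma)%:E).
  apply/integrableP; split; first exact/measurable_EFinP.
  by under eq_integral do rewrite gee0_abs ?lee_fin ?powR_ge0//.
apply: (le_integrable measurableT _ _ (integrableD measurableT i1 i2)).
  by apply/measurable_EFinP; exact: measurable_weight.
move=> x _ /=; rewrite lee_fin !ger0_norm ?addr_ge0 ?powR_ge0//.
exact: weight_enorm.
Qed.

Lemma integrable_grows (m : {measure set @Rd R d -> \bar R}) gamma (f : 'rV[R]_d -> R) :
  measurable_fun setT (f : @Rd R d -> R) -> grows gamma f ->
  m.-integrable setT (EFin \o @weight R d gamma) ->
  m.-integrable setT (EFin \o f).
Proof.
move=> mf [M M0 fM] iw.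
apply: (le_integrable measurableT _ _ (integrableZl measurableT M iw)).
  exact/measurable_EFinP.
by move=> x _ /=; rewrite lee_fin (le_trans (fM x))// ler_norm.
Qed.

End moments.

(** * Measurability of both kernels on the product space *)

Section kernels.
Local Open Scope classical_set_scope.
Context {R : realType} {d : nat} (Phi : 'rV[R]_d -> R) (cPhi : continuous Phi).

Let mPhi : measurable_fun setT (Phi : @Rd R d -> R).
Proof. exact: continuous_measurable_Rd. Qed.

Lemma measurable_Ktilde : measurable_fun setT
  (fun z : @Rd R d * @Rd R d => Ktilde Phi z.1 z.2).
Proof. exact: (measurableT_comp mPhi measurable_subRd). Qed.

Lemma measurable_shiftr (c : 'rV[R]_d) :
  measurable_fun setT (fun x : @Rd R d => Phi (x - c)).
Proof.
exact: (measurableT_comp measurable_Ktilde (@pair2_measurable _ _ (@Rd R d) (@Rd R d) c)).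
Qed.

Lemma measurable_shiftl (c : 'rV[R]_d) :
  measurable_fun setT (fun x : @Rd R d => Phi (c - x)).
Proof.
exact: (measurableT_comp measurable_Ktilde (@pair1_measurable _ _ (@Rd R d) (@Rd R d) c)).
Qed.

Lemma measurable_Kred r N (xi : 'I_N -> 'rV[R]_d) pl : lagrange_basis r xi pl ->
  measurable_fun setT (fun z : @Rd R d * @Rd R d => Kred Phi xi pl z.1 z.2).
Proof.
move=> [ppl _].
have mp1 j : measurable_fun setT (fun z : @Rd R d * @Rd R d => pl j z.1).
  exact: (measurableT_comp (poly_measurable (ppl j)) measurable_fst).
have mp2 j : measurable_fun setT (fun z : @Rd R d * @Rd R d => pl j z.2).
  exact: (measurableT_comp (poly_measurable (ppl j)) measurable_snd).
apply: measurable_funD.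
  apply: measurable_funB.
    apply: measurable_funB; first exact: measurable_Ktilde.
    apply: measurable_sum => j; apply: measurable_funM => //.
    exact: (measurableT_comp (measurable_shiftl _) measurable_snd).
  apply: measurable_sum => j; apply: measurable_funM => //.
  exact: (measurableT_comp (measurable_shiftr _) measurable_fst).
apply: measurable_sum => j; apply: measurable_sum => k.
by apply: measurable_funM => //; exact: measurable_funM.
Qed.

End kernels.

(** * Difference of the two kernels and the conclusion *)

Lemma Ktilde_decomp (R : realType) (d N : nat) (Phi : 'rV[R]_d -> R)
    (xi : 'I_N -> 'rV[R]_d) pl (x y : 'rV[R]_d) :
  Ktilde Phi x y = Kred Phi xi pl x y + (\sum_j pl j x * Phi (xi j - y) +
    (\sum_k Phi (x - xi k) * pl k y +
     \sum_j \sum_k (- Phi (xi j - xi k) * pl j x) * pl k y)).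
Proof.
(* The sign and the constant are absorbed into the factor in [x], so that every summand is a tensor
   [F(x) G(y)]. *)
have -> : \sum_j \sum_k (- Phi (xi j - xi k) * pl j x) * pl k y =
    - \sum_j \sum_k pl j x * pl k y * Phi (xi j - xi k).
  rewrite -sumrN; apply: eq_bigr => j _; rewrite -sumrN.
  by apply: eq_bigr => k _; ring.
rewrite /Ktilde /Kred; under [X in _ + (_ + (X + _))]eq_bigr do rewrite mulrC.
by ring.
Qed.

Theorem mainTheorem12 (R : realType) (d r : nat) (alpha C : R)
    (Phi : 'rV[R]_d -> R) (N : nat) (xi : 'I_N -> 'rV[R]_d)
    (pl : 'I_N -> 'rV[R]_d -> R) :
  (1 <= d)%N -> (1 <= r)%N -> 0 < alpha ->
  CP r Phi ->
  (forall x, `|Phi x| <= C * (1 + enorm x `^ alpha)) ->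
  N = 'C(d + r - 1, r - 1) ->
  unisolvent r xi ->
  lagrange_basis r xi pl ->
  let beta : R := Num.max (r.-1)%:R (((r.-1)%:R + alpha) / 2) in
  [/\ (* (i) *)
      (forall mu nu : {charge set Rd d -> \bar R},
         Mmom alpha mu -> Mmom alpha nu ->
         ((cvar (csub mu nu) \x cvar (csub mu nu))%E).-integrable setT
           (fun z : Rd d * Rd d => (Ktilde Phi z.1 z.2)%:E)),
      (* (ii) *)
      (forall mu nu : {charge set Rd d -> \bar R},
         Mmom beta mu -> Mmom beta nu ->
         ((cvar (csub mu nu) \x cvar (csub mu nu))%E).-integrable setT
           (fun z : Rd d * Rd d => (Kred Phi xi pl z.1 z.2)%:E)) &
      (* (iii) *)
      (forall mu nu : {charge set Rd d -> \bar R},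
         Mmom alpha mu -> Mmom alpha nu -> Mmom beta mu -> Mmom beta nu ->
         (forall p, poly_le r.-1 p ->
            cintegral mu (fun x => (p x)%:E) = cintegral nu (fun x => (p x)%:E)) ->
         cintegral2 (csub mu nu) (fun z : Rd d * Rd d => (Ktilde Phi z.1 z.2)%:E)
         = cintegral2 (csub mu nu) (fun z : Rd d * Rd d => (Kred Phi xi pl z.1 z.2)%:E))].
Proof.
move=> _ _ alpha0 cp hPhi _ uni lag beta.
have [cPhi _ _] := cp; have [ppl _] := lag.
have beta_r : (r.-1)%:R <= beta by rewrite /beta le_max lexx.
have beta0 : 0 <= beta by apply: le_trans beta_r.
have [L L0 hL] := weightB_bound alpha0 hPhi.
have [M M0 hM] := Kred_bound alpha0 cp hPhi uni lag.
have mKred := measurable_Kred cPhi lag.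
split=> mu nu.
- move=> /(Mmom_weight (ltW alpha0)) imu /(Mmom_weight (ltW alpha0)) inu.
  have [_ _ iw] := integrable_diff imu inu.
  apply: (@integrable_tensor_bound _ _ _ (finite_cvar (csub mu nu)) (finite_cvar (csub mu nu))
    _ (fun z => Ktilde Phi z.1 z.2) L _ iw iw).
    exact: measurable_Ktilde.
  by move=> z; exact: hL.
- move=> /(Mmom_weight beta0) imu /(Mmom_weight beta0) inu.
  have [_ _ iw] := integrable_diff imu inu.
  apply: (@integrable_tensor_bound _ _ _ (finite_cvar (csub mu nu)) (finite_cvar (csub mu nu))
    _ (fun z => Kred Phi xi pl z.1 z.2) M mKred iw iw).
  by move=> z; exact: hM.
move=> /(Mmom_weight (ltW alpha0)) amu /(Mmom_weight (ltW alpha0)) anu.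
move=> /(Mmom_weight beta0) bmu /(Mmom_weight beta0) bnu eqp.
have [aP aN _] := integrable_diff amu anu.
have [bP bN _] := integrable_diff bmu bnu.
have ia b : (cpart (csub mu nu) b).-integrable setT (EFin \o @weight R d alpha).
  by case: b.
have ib b : (cpart (csub mu nu) b).-integrable setT (EFin \o @weight R d beta).
  by case: b.
have pl_grows j : grows beta (pl j) := growsW beta_r (poly_grows (ppl j)).
have mpl j := poly_measurable (ppl j).
have ip j b : (cpart (csub mu nu) b).-integrable setT (EFin \o (pl j : Rd d -> R)).
  exact: integrable_grows (pl_grows j) (ib b).
(* Translates of [Phi] are controlled by the [alpha]-moment, the Lagrange polynomials by the
   [beta]-moment. *)
have il z b : (cpart (csub mu nu) b).-integrable setT
    (EFin \o (fun x : Rd d => Phi (z - x))).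
  apply: integrable_grows (grows_shiftl z alpha0 hPhi) (ia b).
  exact: measurable_shiftl.
have ir z b : (cpart (csub mu nu) b).-integrable setT
    (EFin \o (fun x : Rd d => Phi (x - z))).
  apply: integrable_grows (grows_shiftr z alpha0 hPhi) (ia b).
  exact: measurable_shiftr.
(* Equality of the moments of [mu] and [nu] enters here, only through the Lagrange polynomials. *)
have bal j : (\int[cpos (csub mu nu)]_x (pl j x)%:E =
              \int[cneg (csub mu nu)]_x (pl j x)%:E)%E.
  apply: cpos_cneg_integral_eq; last exact: eqp.
  - exact: integrable_grows (pl_grows j) bmu.
  - exact: integrable_grows (pl_grows j) bnu.
have Kred_int : cintegrable2 (csub mu nu) (fun z => Kred Phi xi pl z.1 z.2).
  by move=> b1 b2; apply: (integrable_tensor_bound mKred (ib b1) (ib b2)) => z.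
(* In the first sum the vanishing factor is the polynomial in [x], in the other two the polynomial
   in [y]. *)
have [rest_int rest0] : null2 (csub mu nu) (fun z : Rd d * Rd d =>
    \sum_j pl j z.1 * Phi (xi j - z.2) +
    (\sum_k Phi (z.1 - xi k) * pl k z.2 +
     \sum_j \sum_k (- Phi (xi j - xi k) * pl j z.1) * pl k z.2)).
  apply: null2D; last apply: null2D.
  - apply: null2_sum => j.
    exact: (null2_tensor (ip j) (il (xi j)) (or_introl (bal j))).
  - apply: null2_sum => k.
    exact: (null2_tensor (ir (xi k)) (ip k) (or_intror (bal k))).
  apply: null2_sum => j; apply: null2_sum => k.
  apply: (@null2_tensor _ _ (@Rd R d) _ (fun x => - Phi (xi j - xi k) * pl j x) _
    _ (ip k) (or_intror (bal k))) => b.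
  apply: integrable_grows (growsZ _ (pl_grows j)) (ib b).
  exact: measurable_funM.
transitivity (cintegral2 (csub mu nu) (fun z : Rd d * Rd d =>
  (Kred Phi xi pl z.1 z.2 + (\sum_j pl j z.1 * Phi (xi j - z.2) +
    (\sum_k Phi (z.1 - xi k) * pl k z.2 +
     \sum_j \sum_k (- Phi (xi j - xi k) * pl j z.1) * pl k z.2)))%:E)).
  by congr cintegral2; apply/funext => z; rewrite (Ktilde_decomp Phi xi pl).
by rewrite (cintegral2D Kred_int rest_int) rest0 adde0.
Qed.
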